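(* Let $\Gamma$ be a strongly regular graph with parameters $(99,14,1,2)$ and let $G=\mathrm{Aut}(\Gamma)$ be its full automorphism group. Then $G$ does not contain any element of order $14$.
   Context: A strongly regular graph with parameters $(v,k,\lambda,\mu)$ is a simple $k$-regular graph on $v$ vertices in which any two adjacent vertices have exactly $\lambda$ common neighbors and any two distinct nonadjacent vertices have exactly $\mu$ common neighbors. *)

(* Defs.v *)
From mathcomp Require Import all_boot all_fingroup.

Set Implicit Arguments.
Unset Strict Implicit.
Unset Printing Implicit Defensive.

(* A simple graph on a finite vertex type is its adjacency relation. *)
Definition simple_graph (V : finType) (adj : rel V) : Prop :=
  symmetric adj /\ irreflexive adj.

Definition neighbors (V : finType) (adj : rel V) (x : V) : {set V} :=
  [set y | adj x y].

Definition common_neighbors (V : finType) (adj : rel V) (x y : V) : {set V} :=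
  neighbors adj x :&: neighbors adj y.

Record strongly_regular (V : finType) (adj : rel V) (v k l m : nat) : Prop :=
  StronglyRegular {
    srg_simple : simple_graph adj;
    srg_order : #|V| = v;
    srg_regular : forall x, #|neighbors adj x| = k;
    srg_adjacent : forall x y, adj x y -> #|common_neighbors adj x y| = l;
    srg_nonadjacent : forall x y, x != y -> ~~ adj x y ->
      #|common_neighbors adj x y| = m
  }.

Definition graph_aut (V : finType) (adj : rel V) : {set {perm V}} :=
  [set s : {perm V} | [forall x, forall y, adj (s x) (s y) == adj x y]].

Lemma graph_autP (V : finType) (adj : rel V) (s : {perm V}) :
  reflect (forall x y, adj (s x) (s y) = adj x y) (s \in graph_aut adj).
Proof.
rewrite inE; apply: (iffP forallP) => [H x y|H x].
  by move/forallP: (H x) => /(_ y)/eqP.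
by apply/forallP => y; apply/eqP.
Qed.

Lemma graph_aut_group_set (V : finType) (adj : rel V) :
  group_set (graph_aut adj).
Proof.
apply/group_setP; split=> [|s t /graph_autP Hs /graph_autP Ht].
  by apply/graph_autP => x y; rewrite !perm1.
by apply/graph_autP => x y; rewrite !permM Ht Hs.
Qed.

Canonical graph_aut_group (V : finType) (adj : rel V) :=
  Group (graph_aut_group_set adj).

(* Main.v *)
Require Import Defs.
From mathcomp Require Import all_boot all_fingroup all_solvable all_algebra zify.

(** An automorphism fixing a vertex [p] and its neighborhood [N(p)] pointwise is
    trivial, because a vertex not joined to [p] is determined by its two
    neighbors in [N(p)].  Hence, if [g] has order 14, [g ^ 2] fixes a single
    vertex [p], so [g] fixes [p], and [N(p)] turns out to be a regular orbit of
    [<[g]>].  Numbering [N(p)] by the integers mod 14 so that [g] acts as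
    [u |-> u + 1], the edges inside [N(p)] are the pairs [{u, u + 7}], and the 84
    vertices not joined to [p] correspond to the other pairs; these form six
    regular orbits, the [i]-th one consisting of the pairs [{u, u + i + 1}]
    ([i < 6]).  Let [D i j] be the number of neighbors in orbit [j] of a vertex
    of orbit [i].  Then [D] is symmetric with row sums 12 and
    [D ^ 2 + D = 12 I + 24 J]; moreover the entries of a row in the columns [j] with
    [j + 1] odd have an even sum, as one sees by counting edges towards the even
    half of [N(p)].  A finite search shows that no such matrix of natural numbers
    exists.  (Without the parity condition there is one, up to permutation.) *)

Set Implicit Arguments.
Unset Strict Implicit.
Unset Printing Implicit Defensive.

(** * The orbit matrix *)

Definition dot (r s : seq nat) : nat := sumn [seq x.1 * x.2 | x <- zip r s].

Fixpoint compositions (n s : nat) : seq (seq nat) :=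
  if n is n'.+1 then
    [seq v :: r | v <- iota 0 s.+1, r <- compositions n' (s - v)]
  else if s == 0 then [:: [::]] else [::].

(** By symmetry [dot r r] is a diagonal entry of [D ^ 2], whence 36 = 24 + 12; the indices 0, 2, 4
    are the columns [j] with [j + 1] odd. *)
Definition candidate_rows (i : nat) : seq (seq nat) :=
  [seq r <- compositions 6 12 |
    (dot r r + nth 0 r i == 36) && ~~ odd (nth 0 r 0 + nth 0 r 2 + nth 0 r 4)].

(** Symmetry, and the off-diagonal entries of [D ^ 2 + D] for the new row against each earlier
    one. *)
Definition extends (acc : seq (seq nat)) (r : seq nat) : bool :=
  all (fun i => let a := nth [::] acc i in
         (nth 0 a (size acc) == nth 0 r i) && (dot a r + nth 0 a (size acc) == 24))
      (iota 0 (size acc)).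

(* [tbl] lists the candidates for the rows following those of [acc]. *)
Fixpoint no_completion (tbl : seq (seq (seq nat))) (acc : seq (seq nat)) : bool :=
  if tbl is rs :: tbl' then
    all (fun r => if extends acc r then no_completion tbl' (rcons acc r) else true) rs
  else false.

Lemma no_completion_candidate_rows :
  no_completion [seq candidate_rows i | i <- iota 0 6] [::].
Proof. by vm_compute. Qed.

Lemma mem_compositions (r : seq nat) : r \in compositions (size r) (sumn r).
Proof.
elim: r => [|v r IHr] //; apply/allpairsPdep; exists v, r.
by rewrite mem_iota /= ltnS leq_addr addKn.
Qed.

(** The rows of an actual matrix form a branch that the search cannot close: it reaches the empty
    table, where [no_completion] is false. *)
Lemma no_completionPn (rows : nat -> seq (seq nat)) (R : nat -> seq nat) (n k : nat) :
    (forall i, i < k + n -> R i \in rows i) ->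
    (forall i, i < k + n -> extends (mkseq R i) (R i)) ->
  ~~ no_completion [seq rows i | i <- iota k n] (mkseq R k).
Proof.
elim: n k => [|n IHn] k R_rows R_ext //=; have lt_k : k < k + n.+1 by lia.
apply/allPn; exists (R k); first exact: R_rows.
by rewrite R_ext // -mkseqS; apply: IHn => i; rewrite addSnnS; [apply: R_rows | apply: R_ext].
Qed.

Lemma no_orbit_matrix (D : 'I_6 -> 'I_6 -> nat) :
    (forall i j, D i j = D j i) ->
    (forall i, \sum_j D i j = 12) ->
    (forall i k, \sum_j D i j * D j k + D i k = 24 + 12 * (i == k)) ->
    (forall i, ~~ odd (\sum_(j < 6 | ~~ odd j) D i j)) ->
  False.
Proof.
move=> D_sym D_sum D_sqr D_par.
pose R i := [seq D (inord i) j | j <- enum 'I_6].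
have nthR i j : j < 6 -> nth 0 (R i) j = D (inord i) (inord j).
  move=> lt_j; rewrite (nth_map ord0) ?size_enum_ord //.
  by congr (D _ _); apply: val_inj; rewrite /= nth_enum_ord ?inordK.
have dotR i k : dot (R i) (R k) = \sum_j D (inord i) j * D j (inord k).
  rewrite /dot /R zip_map -map_comp sumnE big_map big_enum /=.
  by apply: eq_bigr => j _; rewrite [D j _]D_sym.
have sumR i : sumn (R i) = 12 by rewrite sumnE big_map big_enum /= D_sum.
have: ~~ no_completion [seq candidate_rows i | i <- iota 0 6] (mkseq R 0).
  apply: no_completionPn => i lt_i.
    rewrite mem_filter dotR !nthR // D_sqr !eqxx andTb; apply/andP; split.
      move: (D_par (inord i)); rewrite !big_mkcond !big_ord_recl big_ord0 /=.
      congr (~~ odd _); rewrite !add0n !addn0 addnA.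
      by congr (_ + _ + _); congr (D _ _); apply: val_inj; rewrite /= inordK.
    by have := mem_compositions (R i); rewrite sumR size_map size_enum_ord.
  apply/allP => j; rewrite size_mkseq mem_iota => /andP[_ lt_j] /=.
  have lt_j6 : j < 6 by lia.
  rewrite nth_mkseq // !nthR // dotR D_sym eqxx D_sym D_sqr /= -val_eqE /= !inordK //.
  by rewrite (ltn_eqF lt_j).
by rewrite no_completion_candidate_rows.
Qed.

(** * Automorphisms *)

Section Conway.

Variables (V : finType) (adj : rel V).
Hypothesis srg : strongly_regular adj 99 14 1 2.

Let adjC : symmetric adj.
Proof. by case: srg => [] []. Qed.

Let adjxx x : adj x x = false.
Proof. by case: srg => [] [_ ->]. Qed.

(** * Common neighbors, triangles and quadrangles *)

Lemma neighbor_neq x y : adj x y -> x != y.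
Proof. by apply: contraTneq => ->; rewrite adjxx. Qed.

(** The adjacency term merges the three cases 14 + 0, 1 + 1 and 2 + 0 into the matrix identity
    [A ^ 2 + A = 12 I + 2 J]. *)
Lemma common_neighbors_count x y :
  #|common_neighbors adj x y| + adj x y = 2 + 12 * (x == y).
Proof.
case: eqVneq => [<-|neq_xy]; first by rewrite adjxx /common_neighbors setIid (srg_regular srg).
by case: (boolP (adj x y)) => [/(srg_adjacent srg)|/(srg_nonadjacent srg neq_xy)] ->.
Qed.

Lemma sum_common_neighbors x y :
  \sum_z adj x z * adj z y + adj x y = 2 + 12 * (x == y).
Proof.
rewrite -common_neighbors_count -sum1_card [X in _ = X + _]big_mkcond /=; congr (_ + _).
by apply: eq_bigr => z _; rewrite !inE (adjC y); case: (adj x z); case: (adj z y).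
Qed.

Lemma sum_neighbors x : \sum_z adj x z = 14.
Proof.
rewrite -(srg_regular srg x) -sum1_card [RHS]big_mkcond /=.
by apply: eq_bigr => z _; rewrite inE; case: adj.
Qed.

Lemma triangle x y : adj x y -> exists z, adj x z && adj y z.
Proof.
move=> /(srg_adjacent srg)/eqP/cards1P[z Dz]; exists z.
by have:= set11 z; rewrite -Dz !inE.
Qed.

Lemma triangle_uniq x y z w :
  adj x y -> adj x z -> adj y z -> adj x w -> adj y w -> z = w.
Proof.
move=> /(srg_adjacent srg)/eqP/cards1P[c Dc] xz yz xw yw.
have eq_c u : adj x u -> adj y u -> u = c.
  by move=> xu yu; apply/set1P; rewrite -Dc !inE xu.
by rewrite (eq_c z) // (eq_c w).
Qed.

Lemma quadrangle x y : x != y -> ~~ adj x y ->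
  exists a c, [/\ a != c, adj x a, adj y a, adj x c & adj y c].
Proof.
move=> neq_xy nadj; have /eqP/cards2P[a [c [neq_ac D]]] := srg_nonadjacent srg neq_xy nadj.
have := set22 a c; have := set21 a c; rewrite -D !inE => /andP[xa ya] /andP[xc yc].
by exists a, c.
Qed.

Lemma quadrangle_uniq x y a c z : x != y -> ~~ adj x y -> a != c ->
  adj x a -> adj y a -> adj x c -> adj y c -> adj x z -> adj y z -> (z == a) || (z == c).
Proof.
move=> neq_xy nadj neq_ac xa ya xc yc xz yz.
suff D: [set a; c] = common_neighbors adj x y by rewrite -in_set2 D !inE xz.
apply/eqP; rewrite eqEcard (srg_nonadjacent srg) // cards2 neq_ac andbT.
by apply/subsetP => u /set2P[] ->; rewrite !inE ?xa ?xc.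
Qed.

Lemma quadrangle_nonadj x y a c :
  x != y -> adj x a -> adj y a -> adj x c -> adj y c -> ~~ adj a c.
Proof.
move=> neq_xy xa ya xc yc; apply: contra neq_xy => ac; apply/eqP.
by apply: (triangle_uniq ac); rewrite adjC.
Qed.

(** * Automorphisms fixing a vertex *)

Lemma autE (h : {perm V}) x y : h \in graph_aut adj -> adj (h x) (h y) = adj x y.
Proof. by move/graph_autP. Qed.

Lemma aut_fix_neighborhood (h : {perm V}) p :
  h \in graph_aut adj -> h p = p -> (forall a, adj p a -> h a = a) -> h = 1%g.
Proof.
move=> hA hp fixN; apply/permP => x; rewrite perm1.
have [->//|neq_xp] := eqVneq x p.
have [/fixN//|npx] := boolP (adj p x).
have neq_px : p != x by rewrite eq_sym.
have [a [c [neq_ac pa xa pc xc]]] := quadrangle neq_px npx.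
have nac := quadrangle_nonadj neq_px pa xa pc xc.
have hax : adj a (h x) by rewrite -{1}(fixN a pa) autE // adjC.
have hcx : adj c (h x) by rewrite -{1}(fixN c pc) autE // adjC.
rewrite !(adjC _ a) !(adjC _ c) in pa xa pc xc.
(* The common neighbors of [a] and [c] are [p] and [x]. So [h x] is one of these, and it is not [p],
   since [h] is injective and fixes [p]. *)
have /orP[/eqP|/eqP//] := quadrangle_uniq neq_ac nac neq_px pa pc xa xc hax hcx.
by rewrite -{1}hp => /perm_inj eq_xp; rewrite eq_xp eqxx in neq_xp.
Qed.

Lemma perm_fix_coprime (h : {perm V}) m n x :
  coprime m n -> 0 < m -> (h ^+ m)%g x = x -> (h ^+ n)%g x = x -> h x = x.
Proof.
move=> co_mn m_gt0 hm hn.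
have fixX k l : (h ^+ k)%g x = x -> (h ^+ (k * l))%g x = x.
  by move=> hk; rewrite expgM permX; elim: l => //= l ->.
case: (egcdnP n m_gt0) => km kn def_km _.
have := fixX m km hm; rewrite mulnC def_km (eqP co_mn) expgD expg1 permM mulnC.
by rewrite fixX.
Qed.

(* The third vertex [a'] of the triangle on [p], [a] is not in the orbit of [a]:
   from [a' = h ^ k a] would follow [h ^ (2 * k) a = a].  So the orbits of [a]
   and [a'], both of length 7, fill [N(p)]. *)
Lemma aut7_neighborhood (h : {perm V}) p a c :
    h \in graph_aut adj -> h p = p -> adj p a -> (h ^+ 7)%g a = a -> h a != a ->
    adj p c -> (h ^+ 7)%g c = c /\ h c != c.
Proof.
move=> hA hp pa h7a hNa pc.
have hXA k : (h ^+ k)%g \in graph_aut adj by rewrite groupX.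
have hXp k : (h ^+ k)%g p = p by rewrite permX; elim: k => //= k ->.
have [a' /andP[pa' aa']] := triangle pa.
have mate_uniq z : adj p z -> adj a z -> z = a'.
  by move=> pz az; apply: (triangle_uniq pa).
have h7a' : (h ^+ 7)%g a' = a'.
  by apply: mate_uniq; [rewrite -(hXp 7) | rewrite -h7a]; rewrite autE.
have hNa' : h a' != a'.
  apply: contraNneq hNa => ha'; apply/eqP; apply: (triangle_uniq pa') => //.
  - by rewrite -hp autE.
  - by rewrite -[a' in adj a' _]ha' autE // adjC.
  - by rewrite adjC.
have fixX7 k z : (h ^+ 7)%g z = z -> (h ^+ (7 * k))%g z = z.
  by move=> h7z; rewrite expgM permX; elim: k => //= k ->.
have cross m n : (h ^+ m)%g a != (h ^+ n)%g a'.
  (* Modulo 7, [6 * n] acts as [- n] while keeping the exponent natural. *)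
  apply/eqP => eq_mn; pose k := m + 6 * n.
  have hka : (h ^+ k)%g a = a'.
    by rewrite expgD permM eq_mn -permM -expgD -mulSn fixX7.
  have hka' : (h ^+ k)%g a' = a.
    apply: (triangle_uniq pa') => //; last by rewrite adjC.
      by rewrite -(hXp k) autE.
    by rewrite -{1}hka autE.
  have [/dvdnP[q Dk]|] := boolP (7 %| k).
    by move: (neighbor_neq aa'); rewrite -hka Dk mulnC fixX7 // eqxx.
  move=> ndvd; case/eqP: hNa; apply: (@perm_fix_coprime _ 7 (k + k)) => //.
    by rewrite prime_coprime //; lia.
  by rewrite expgD permM hka.
have free z m n : (h ^+ 7)%g z = z -> h z != z -> m < 7 -> n < 7 ->
    (h ^+ m)%g z = (h ^+ n)%g z -> m = n.
  move=> h7z hNz; wlog le_mn: m n / m <= n => [IH|lt_m lt_n eq_mn].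
    have [/IH//|/ltnW/IH le_nm lt_m lt_n /esym] := leqP m n.
    by move/(le_nm lt_n lt_m).
  apply/eqP; apply: contraNT hNz => neq_mn; apply/eqP.
  apply: (@perm_fix_coprime _ 7 (n - m)) => //.
    by rewrite prime_coprime // gtnNdvd //; lia.
  by apply: (@perm_inj _ (h ^+ m)%g); rewrite -permM -expgD subnK // eq_mn.
pose f (u : 'I_7 * bool) := (h ^+ u.1)%g (if u.2 then a' else a).
have f_inj : injective f.
  case=> [i [|]] [j [|]]; rewrite /f /= => eq_f; try by case/eqP: (cross i j).
  - by congr (_, _); apply: val_inj; apply: free eq_f.
  - by have /eqP[] := cross j i.
  - by congr (_, _); apply: val_inj; apply: free eq_f.
have f_onto : f @: setT = neighbors adj p.
  apply/eqP; rewrite eqEcard card_imset // cardsT card_prod card_ord card_bool.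
  rewrite (srg_regular srg) leqnn andbT; apply/subsetP => _ /imsetP[[i e] _ ->].
  by rewrite inE /f -(hXp i) autE //; case: (e).
have: c \in neighbors adj p by rewrite inE.
rewrite -f_onto => /imsetP[[i e] _ ->] {c pc}; rewrite /f /=.
have [h7z hNz] : (h ^+ 7)%g (if e then a' else a) = (if e then a' else a)
    /\ h (if e then a' else a) != (if e then a' else a) by case: (e).
split; first by rewrite -permM -expgD addnC expgD permM h7z.
by rewrite -permM -expgSr expgS permM (inj_eq perm_inj).
Qed.

(** If [s] moved one neighbor of [p], it would move them all; so a fixed neighbor forces [s] to fix
    all of them and to be trivial. *)
Lemma aut7_no_fixed_neighbor (s : {perm V}) p a :
  s \in graph_aut adj -> #[s]%g = 7 -> s p = p -> adj p a -> s a != a.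
Proof.
move=> sA os sp pa; have: s != 1%g by rewrite -order_gt1 os.
apply: contraNneq => sa; apply/eqP; apply: (aut_fix_neighborhood sA sp) => c pc.
apply/eqP; apply: contraPT sa => sNc; apply/eqP.
have s7c : (s ^+ 7)%g c = c by rewrite -os expg_order perm1.
by have [] := aut7_neighborhood sA sp pc s7c sNc pa.
Qed.

(** A fixed vertex exists because 99 is not divisible by 7. Two of them would be nonadjacent, and
    [s], of odd order, would fix both of their common neighbors. *)
Lemma aut7_fix_uniq (s : {perm V}) :
  s \in graph_aut adj -> #[s]%g = 7 -> exists p, s p = p /\ (forall q, s q = q -> q = p).
Proof.
move=> sA os; have s7E x : (s ^+ 7)%g x = x by rewrite -os expg_order perm1.
have noN p a : s p = p -> adj p a -> s a != a by apply: aut7_no_fixed_neighbor.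
have fix_mod : #|V| = #|'Fix_('P)(<[s]>)%g| %[mod 7].
  rewrite -[#|V|]cardsT; have s7grp : (7.-group <[s]>)%g by rewrite /pgroup -orderE os.
  rewrite (pgroup_fix_mod s7grp (to := 'P) (S := setT)) ?setTI //.
  by apply/actsP => u _ x; rewrite !inE.
have [p sp] : exists p, s p = p.
  have: 0 < #|'Fix_('P)(<[s]>)%g|.
    by move: fix_mod; rewrite (srg_order srg); case: #|_|.
  case/card_gt0P => p /afixP/(_ s (cycle_id s)) sp; by exists p.
exists p; split=> // q sq; apply/eqP; apply/negP => neq_qp.
have neq_pq : p != q by rewrite eq_sym; apply/negP.
have npq : ~~ adj p q by apply/negP => /(noN p q sp); rewrite sq eqxx.
have [a [c [neq_ac pa qa pc qc]]] := quadrangle neq_pq npq.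
have s_ac z : adj p z -> adj q z -> (z == a) || (z == c).
  exact: quadrangle_uniq neq_pq npq neq_ac pa qa pc qc.
have sN z : adj p z -> adj q z -> adj p (s z) && adj q (s z).
  by move=> pz qz; rewrite -{1}sp -{1}sq !autE // pz.
have /andP[psa qsa] := sN a pa qa; have /andP[pssa qssa] := sN _ psa qsa.
have sac : s a = c by have /orP[/eqP sa|/eqP//] := s_ac _ psa qsa; have /eqP[] := noN p a sp pa.
have ssa : s (s a) = a.
  have /orP[/eqP//|/eqP ssa] := s_ac _ pssa qssa.
  by have := noN p c sp pc; rewrite -{1}sac ssa eqxx.
case/eqP: (noN p a sp pa); apply: (@perm_fix_coprime _ 7 2) => //.
by rewrite expgS expg1 permM.
Qed.

(* Either [g ^ 7] fixes [a], hence all of [N(p)], or [a] has a regular orbit. *)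
Lemma aut14_regular (g : {perm V}) :
    g \in graph_aut adj -> #[g]%g = 14 ->
  exists p a, [/\ g p = p, adj p a & forall m, (g ^+ m)%g a = a -> 14 %| m].
Proof.
move=> gA og; have sA : (g ^+ 2)%g \in graph_aut adj by rewrite groupX.
have os : #[g ^+ 2]%g = 7 by rewrite orderXdiv og.
have [p [sp p_uniq]] := aut7_fix_uniq sA os.
(* Since [g] commutes with [g ^ 2], it preserves the fixed vertices of [g ^ 2]. *)
have gp : g p = p by apply: p_uniq; rewrite -permM -expgS expgSr permM sp.
have [a pa] : exists a, adj p a.
  have: 0 < #|neighbors adj p| by rewrite (srg_regular srg).
  by case/card_gt0P => a; rewrite inE; exists a.
have sNa := aut7_no_fixed_neighbor sA os sp pa.
exists p, a; split=> // m gm.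
have gX14 k l : k * l = 14 -> ((g ^+ k) ^+ l)%g a = a.
  by move=> kl; rewrite -expgM kl -og expg_order perm1.
have gXX k : ((g ^+ k) ^+ m)%g a = a.
  by rewrite -expgM mulnC expgM permX; elim: k => //= k ->.
rewrite (@Gauss_dvd 2 7) //; apply/andP; split.
  apply/negPn/negP => odd_m.
  have g7a : (g ^+ 7)%g a = a.
    by apply: (@perm_fix_coprime _ 2 m) => //; [rewrite prime_coprime | exact: gX14].
  have gNa : g a != a.
    by apply: contraNneq sNa => ga; rewrite expgS expg1 permM !ga.
  have g7A : (g ^+ 7)%g \in graph_aut adj by rewrite groupX.
  have: (g ^+ 7)%g = 1%g.
    apply: (aut_fix_neighborhood g7A (p := p)) => [|c pc].
      by rewrite permX; elim: 7 => //= k ->.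
    by have [] := aut7_neighborhood gA gp pa g7a gNa pc.
  by move/eqP; rewrite -order_dvdn og.
apply/negPn/negP => ndvd; case/eqP: sNa.
by apply: (@perm_fix_coprime _ 7 m) => //; [rewrite prime_coprime | exact: gX14].
Qed.

(** * Regular action on a neighborhood *)

Section RegularAction.

(** [act u] stands for [g ^ u]; the index type ['I_14] makes exponents add modulo 14. *)
Variables (act : 'I_14 -> V -> V) (p b : V).
Hypotheses (act0 : forall z, act 0%R z = z)
           (actD : forall u v z, act (u + v)%R z = act u (act v z))
           (act_adj : forall u y z, adj (act u y) (act u z) = adj y z)
           (act_p : forall u, act u p = p)
           (act_free : forall u, act u b = b -> u = 0%R)
           (pb : adj p b).

Lemma act_adjB u v y z : adj (act u y) (act v z) = adj y (act (v - u)%R z).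
Proof. by rewrite -[RHS](act_adj u) -actD GRing.addrC GRing.subrK. Qed.

Lemma actK u : cancel (act u) (act (- u)%R).
Proof. by move=> z; rewrite -actD GRing.addNr act0. Qed.

Lemma act_injb : injective (act^~ b).
Proof.
move=> u v /= eq_uv; apply/esym/eqP; rewrite -GRing.subr_eq0; apply/eqP/act_free.
by rewrite GRing.addrC actD -eq_uv -actD GRing.addNr act0.
Qed.

Lemma adj_p_act u : adj p (act u b).
Proof. by rewrite -(act_p u) act_adj. Qed.

Lemma neighbors_orbit c : adj p c -> exists u, c = act u b.
Proof.
have onto : (act^~ b) @: setT = neighbors adj p.
  apply/eqP; rewrite eqEcard card_imset; last exact: act_injb.
  rewrite cardsT card_ord (srg_regular srg) leqnn andbT.
  by apply/subsetP => _ /imsetP[u _ ->]; rewrite inE adj_p_act.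
move=> pc; have: c \in neighbors adj p by rewrite inE.
by rewrite -onto => /imsetP[u _ ->]; exists u.
Qed.

(* The third vertex of the triangle on [p], [b] is [act m b] with [m + m = 0] and [m != 0]. *)
Lemma adj_b_act u : adj b (act u b) = (u == inZp 7).
Proof.
have [c /andP[pc bc]] := triangle pb; have [m Dc] := neighbors_orbit pc.
have m_neq0 : m != 0%R.
  by apply: contraTneq bc => m0; rewrite Dc m0 act0 adjxx.
have mm : (m + m = 0)%R.
  apply: act_free; rewrite actD -Dc; apply: (triangle_uniq pc) => //.
  - by rewrite -(act_p m) act_adj.
  - by rewrite {1}Dc act_adj.
  - by rewrite adjC.
have m7 : m = inZp 7.
  apply: val_inj; move: m_neq0 mm; rewrite -val_eqE => /= m_neq0 /(congr1 val) /=.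
  by have := ltn_ord m; rewrite /=; lia.
apply/idP/eqP => [bu|->]; last by rewrite -m7 -Dc.
apply: act_injb; rewrite /= -m7 -Dc; apply: (triangle_uniq pb) => //.
exact: adj_p_act.
Qed.

(** The residues 1 to 6 represent, up to sign, all differences other than 0 and 7, that is, the
    pairs of nonadjacent vertices of [N(p)]. *)
Definition step (i : 'I_6) : 'I_14 := inZp i.+1.

Lemma val_step i : step i = i.+1 :> nat.
Proof. by rewrite /= modn_small // ltnS (leq_trans (ltn_ord i)). Qed.

Lemma step_inj : injective step.
Proof. by move=> i j /(congr1 (@nat_of_ord 14)); rewrite !val_step => -[/val_inj]. Qed.

Lemma step_neq0 i : step i != 0%R.
Proof. by apply/eqP => /(congr1 (@nat_of_ord 14)); rewrite val_step. Qed.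

Lemma step_neq7 i : step i != inZp 7.
Proof.
by apply/eqP => /(congr1 (@nat_of_ord 14)); rewrite val_step /=; have := ltn_ord i; lia.
Qed.

Lemma stepD_neq0 i j : (step i + step j != 0)%R.
Proof.
apply/eqP => /(congr1 (@nat_of_ord 14)) /=.
by have := ltn_ord i; have := ltn_ord j; lia.
Qed.

Lemma b_neq_step i : b != act (step i) b.
Proof. by apply/eqP => /esym/act_free/eqP; rewrite (negPf (step_neq0 i)). Qed.

(** The nonadjacent vertices [b] and [act (step i) b] have two common neighbors, at most one of
    which is [p]. *)
Lemma exists_second_neighbors :
  exists x : 'I_6 -> V, forall i, [/\ x i != p, adj b (x i) & adj (act (step i) b) (x i)].
Proof.
have ex i : exists z, [/\ z != p, adj b z & adj (act (step i) b) z].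
  have nadj : ~~ adj b (act (step i) b) by rewrite adj_b_act step_neq7.
  have [y [z [neq_yz yb yc zb zc]]] := quadrangle (b_neq_step i) nadj.
  have [Dy|neq_yp] := eqVneq y p; last by exists y.
  by exists z; split; rewrite // -Dy eq_sym.
by have [x Px] := fin_all_exists ex; exists x.
Qed.

(* Under the numbering [u |-> act u b] of [N(p)], [x i] is the vertex of the pair [{0, i + 1}]. *)
Variable x : 'I_6 -> V.
Hypotheses (x_neq : forall i, x i != p) (bx : forall i, adj b (x i))
           (cx : forall i, adj (act (step i) b) (x i)).

Lemma nadj_p_x i : adj p (x i) = false.
Proof.
apply/negbTE/(quadrangle_nonadj (b_neq_step i) _ _ (bx i) (cx i)).
  by rewrite adjC.
by rewrite adjC adj_p_act.
Qed.

Lemma adj_act_x u i : adj (act u b) (x i) = (u == 0%R) || (u == step i).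
Proof.
apply/idP/orP => [ux|[]/eqP-> //]; last by rewrite act0.
have neq_px : p != x i by rewrite eq_sym.
have := quadrangle_uniq (z := act u b) neq_px _ (b_neq_step i) pb.
rewrite !(adjC (x i)) nadj_p_x bx cx ux !adj_p_act.
move=> /(_ isT isT isT isT isT isT)/orP[]/eqP; last by move/act_injb->; right.
by rewrite -{2}[b]act0 => /act_injb->; left.
Qed.

(** The pairs [{0, step i}] and [{0, step j}] would be translates by [u - v]. A nonzero translation
    would have to swap the ends, giving [step i + step j = 0]. *)
Lemma act_x_inj u v i j : act u (x i) = act v (x j) -> u = v /\ i = j.
Proof.
move=> eq_xx; have label w : adj (act w b) (x i) = adj (act (w + (u - v))%R b) (x j).
  rewrite -[LHS](act_adj u) eq_xx -[RHS](act_adj v) -!actD.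
  by rewrite GRing.addrCA [(v + _)%R]GRing.addrC GRing.subrK GRing.addrC.
have := label 0%R; have := label (step i).
rewrite !adj_act_x !eqxx orbT GRing.add0r => + /esym/orP[]/eqP Duv; rewrite Duv.
  rewrite GRing.addr0 (negPf (step_neq0 i)) => /esym/eqP/step_inj.
  by move/eqP: Duv; rewrite GRing.subr_eq0 => /eqP.
rewrite (negPf (stepD_neq0 i j)) /= -[X in _ == X]GRing.add0r.
by rewrite (inj_eq (GRing.addIr _)) (negPf (step_neq0 i)).
Qed.

(** As 1 + 14 + 6 * 14 = 99, the disjoint regular orbits and [p] exhaust the graph. *)
Lemma sum_vertices (F : V -> nat) :
  \sum_y F y = F p + (\sum_u F (act u b) + \sum_j \sum_u F (act u (x j))).
Proof.
pose f (w : 'I_1 + ('I_14 + 'I_6 * 'I_14)) :=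
  match w with inl _ => p | inr (inl u) => act u b | inr (inr (j, u)) => act u (x j) end.
have Npb u : act u b != p by rewrite eq_sym neighbor_neq ?adj_p_act.
have Npx u i : act u (x i) != p.
  by rewrite -(act_p u); apply: contra (x_neq i) => /eqP/(can_inj (actK u))->.
have Nbx u v i : act u b != act v (x i).
  by apply: contraFneq (nadj_p_x i) => eq_bx; rewrite -(act_adj v) act_p -eq_bx adj_p_act.
have f_inj : injective f.
  case=> [u|[u|[i u]]] [v|[v|[j v]]] //= eq_f.
  - by rewrite (ord1 u) (ord1 v).
  - by have /eqP[] := Npb v.
  - by have /eqP[] := Npx v j.
  - by have /eqP[] := Npb u.
  - by rewrite (act_injb eq_f).
  - by have /eqP[] := Nbx u v j.
  - by have /eqP[] := Npx u i.
  - by have /eqP[] := Nbx v u i.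
  - by have [-> ->] := act_x_inj eq_f.
have f_bij : bijective f.
  apply: inj_card_bij f_inj _.
  by rewrite (srg_order srg) !card_sum card_prod !card_ord.
rewrite (reindex f) /=; last exact: onW_bij.
rewrite !big_sumType /= big_ord1 pair_big; congr (_ + (_ + _)).
by apply: eq_bigr => -[].
Qed.

Lemma sum_second_neighbors i (F : V -> nat) :
  \sum_y adj (x i) y * F y =
    \sum_u adj (x i) (act u b) * F (act u b)
    + \sum_j \sum_u adj (x i) (act u (x j)) * F (act u (x j)).
Proof. by rewrite sum_vertices adjC nadj_p_x. Qed.

Lemma sum_adj_orbit_b i : \sum_u adj (x i) (act u b) = 2.
Proof.
under eq_bigr => u _ do rewrite adjC adj_act_x.
rewrite (bigD1 0%R) //= (bigD1 (step i)) ?step_neq0 //= eqxx orbT.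
by rewrite big1 // => u /andP[/negPf-> /negPf->].
Qed.

Lemma sum_adj_shift y z u : \sum_w adj (act u y) (act w z) = \sum_w adj y (act w z).
Proof.
by rewrite (reindex_inj (GRing.addrI u)); apply: eq_bigr => w _; rewrite actD act_adj.
Qed.

Lemma sum_adjC y z : \sum_w adj y (act w z) = \sum_w adj z (act w y).
Proof.
rewrite (reindex_inj (@GRing.oppr_inj _)); apply: eq_bigr => w _.
by rewrite adjC -(act_adj w) -actD GRing.subrr act0.
Qed.

(** * Equations for the orbit matrix *)

Definition orbit_matrix i j := \sum_u adj (x i) (act u (x j)).

Lemma orbit_matrix_row i : \sum_j orbit_matrix i j = 12.
Proof.
apply/(@addnI 2); rewrite -{1}(sum_adj_orbit_b i).
transitivity (\sum_y adj (x i) y * 1).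
  rewrite sum_second_neighbors; under [in RHS]eq_bigr do rewrite muln1.
  by congr (_ + _); apply: eq_bigr => j _; apply: eq_bigr => u _; rewrite muln1.
by under eq_bigr do rewrite muln1; rewrite sum_neighbors.
Qed.

(** Summing [sum_common_neighbors] over the orbit of [x k] gives 28 = 14 * 2; the walks through
    [N(p)] account for 4 = 2 * 2 of it. *)
Lemma orbit_matrix_sqr i k :
  \sum_j orbit_matrix i j * orbit_matrix j k + orbit_matrix i k = 24 + 12 * (i == k).
Proof.
pose F y := \sum_w adj y (act w (x k)).
have total : \sum_y adj (x i) y * F y + orbit_matrix i k = 28 + 12 * (i == k).
  under eq_bigr do rewrite big_distrr /=.
  rewrite exchange_big -big_split /=.
  under eq_bigr do rewrite sum_common_neighbors.
  rewrite big_split sum_nat_const card_ord -big_distrr /=; congr (_ + _ * _).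
  have [<-|neq_ik] := eqVneq i k.
    rewrite (bigD1 0%R) //= act0 eqxx big1 // => w w_neq0; apply/eqP; rewrite eqb0.
    by apply: contra w_neq0 => /eqP; rewrite -{1}[x i]act0 => /act_x_inj[<-].
  rewrite big1 // => w _; apply/eqP; rewrite eqb0.
  by apply: contra neq_ik => /eqP; rewrite -{1}[x i]act0 => /act_x_inj[_ ->].
have Fb u : F (act u b) = 2 by rewrite /F sum_adj_shift sum_adjC sum_adj_orbit_b.
apply/(@addnI 4); rewrite addnA -[RHS]/(28 + _) -total sum_second_neighbors.
congr (_ + _ + _).
  under [in RHS]eq_bigr do rewrite Fb.
  by rewrite -big_distrl /= sum_adj_orbit_b.
apply: eq_bigr => j _; rewrite big_distrl /=; apply: eq_bigr => u _.
by rewrite /F sum_adj_shift.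
Qed.

(* Count the edges between the neighbors of [x i] and the [act w b] with [w] even. *)
Lemma orbit_matrix_even i : ~~ odd (\sum_(j < 6 | ~~ odd j) orbit_matrix i j).
Proof.
pose even (w : 'I_14) : nat := ~~ odd w.
pose F y := \sum_w adj y (act w b) * even w.
have total : \sum_y adj (x i) y * F y + F (x i) = 14.
  under eq_bigr do rewrite big_distrr /=.
  rewrite exchange_big -big_split /=.
  transitivity (\sum_(w < 14) 2 * even w); last by rewrite !big_ord_recl big_ord0.
  apply: eq_bigr => w _.
  have neq_xb : (x i == act w b) = false.
    by apply: contraFF (nadj_p_x i) => /eqP->; apply: adj_p_act.
  have := sum_common_neighbors (x i) (act w b); rewrite neq_xb muln0 addn0 => <-.
  by rewrite mulnDl big_distrl /=; congr (_ + _); apply: eq_bigr => z _; rewrite mulnA.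
(* The only neighbor of [act u b] inside [N(p)] is [act (u + 7) b], whose index has the opposite
   parity. *)
have Fb u : F (act u b) = odd u.
  rewrite /F (reindex_inj (GRing.addIr u)) (bigD1 (inZp 7)) //= big1 => [|w neq_w7].
    by rewrite act_adjB GRing.addrK adj_b_act eqxx /even /= odd_mod // oddD addn0 mul1n negbK.
  by rewrite act_adjB GRing.addrK adj_b_act (negPf neq_w7).
(* The two neighbors in [N(p)] have indices [u] and [u + j + 1]; exactly one is even when [j] is
   even, and none or both otherwise. *)
have Fx u j : odd (F (act u (x j))) = ~~ odd j.
  rewrite /F (reindex_inj (GRing.addIr u)) (bigD1 0%R) //= (bigD1 (step j)) ?step_neq0 //=.
  rewrite big1 => [|w /andP[w_neq0 neq_w]]; last first.
    by rewrite act_adjB GRing.addrK adjC adj_act_x (negPf w_neq0) (negPf neq_w).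
  rewrite !act_adjB !GRing.addrK !(adjC (x j)) !adj_act_x !eqxx orbT !mul1n GRing.add0r.
  by rewrite addn0 oddD !oddb odd_mod // oddD val_step /=; case: (odd u); case: (odd j).
(* Each of the two neighbors [act u b] of [x i] counts once: in the first sum if [u] is odd, in
   [F (x i)] if [u] is even. *)
have sum2 : \sum_u adj (x i) (act u b) * F (act u b) + F (x i) = 2.
  rewrite -big_split /= -[RHS](sum_adj_orbit_b i).
  by apply: eq_bigr => u _; rewrite Fb -mulnDr /even; case: (odd u); rewrite muln1.
have sum12 : \sum_j \sum_u adj (x i) (act u (x j)) * F (act u (x j)) = 12.
  by move: total; rewrite sum_second_neighbors addnAC sum2 => /(@addnI 2).
(* Modulo 2, the factor [F] removes exactly the columns with [j] odd. *)
suff -> : odd (\sum_(j < 6 | ~~ odd j) orbit_matrix i j)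
    = odd (\sum_j \sum_u adj (x i) (act u (x j)) * F (act u (x j))) by rewrite sum12.
rewrite big_mkcond !(big_morph odd oddD (erefl : odd 0 = false)) /=.
apply: eq_bigr => j _; rewrite /orbit_matrix (fun_if odd).
rewrite !(big_morph odd oddD (erefl : odd 0 = false)).
case: ifP => odd_j; last first.
  by rewrite big1 // => u _; rewrite oddM Fx odd_j andbF.
by apply: eq_bigr => u _; rewrite oddM Fx odd_j andbT.
Qed.

Lemma orbit_matrixC i j : orbit_matrix i j = orbit_matrix j i.
Proof. exact: sum_adjC. Qed.

End RegularAction.

Lemma no_regular_action (act : 'I_14 -> V -> V) p b :
    (forall z, act 0%R z = z) ->
    (forall u v z, act (u + v)%R z = act u (act v z)) ->
    (forall u y z, adj (act u y) (act u z) = adj y z) ->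
    (forall u, act u p = p) -> (forall u, act u b = b -> u = 0%R) -> adj p b ->
  False.
Proof.
move=> act0 actD act_adj act_p act_free pb.
have [x Px] := exists_second_neighbors act0 actD act_adj act_p act_free pb.
have x_neq i : x i != p by case: (Px i).
have bx i : adj b (x i) by case: (Px i).
have cx i : adj (act (step i) b) (x i) by case: (Px i).
apply: (@no_orbit_matrix (orbit_matrix act x)).
- exact: orbit_matrixC.
- exact: orbit_matrix_row x_neq bx cx.
- exact: orbit_matrix_sqr x_neq bx cx.
- exact: orbit_matrix_even x_neq bx cx.
Qed.

End Conway.

Theorem theorem3p11 (V : finType) (adj : rel V)
    (srg : strongly_regular adj 99 14 1 2) :
  ~ (exists g : {perm V}, g \in graph_aut adj /\ #[g]%g = 14).
Proof.
case=> g [gA og]; have [p [b [gp pb free]]] := aut14_regular srg gA og.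
apply: (no_regular_action srg (act := fun (u : 'I_14) z => (g ^+ u)%g z) (p := p) (b := b)) => //.
- by move=> z; rewrite expg0 perm1.
- move=> u v z; rewrite -permM -expgD addnC.
  by rewrite -(expg_mod_order g (u + v)) og.
- by move=> u y z; apply/graph_autP; rewrite groupX.
- by move=> u; rewrite permX; elim: (u : nat) => //= k ->.
- move=> u /free dvd_u; apply/val_inj/eqP => /=.
  by apply: contraTT dvd_u => u_neq0; rewrite gtnNdvd ?lt0n.
Qed.
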